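(* For all $\alpha,\beta\in(0,1)$ there exist test statistics $S=(S^{(1)},\dots,S^{(m)})$, combination functions $C_m:\mathbb{R}^m\to\mathbb{R}$ and tests $T_\alpha$ of level $\alpha$ satisfying the conditions (A1)–(A3) below, such that if $$\rho^2\ge C_{\alpha,\beta}\,\frac{(\sqrt m\wedge d)\sqrt d}{mn},$$ we have $$\sup_{f\in H_\rho}\mathbb{P}_f(T_\alpha=0)\le\beta$$ for a large enough constant $C_{\alpha,\beta}>0$ depending only on $\alpha,\beta\in(0,1)$, for all $n,m,d\in\mathbb{N}$. (A1) There are measurable functions $f_j:\mathbb{R}^d\times\mathbb{R}\to\mathbb{R}$ and independent random variables $U^{(1)},\dots,U^{(m)}$, which are independent of the data $X=(X^{(1)},\dots,X^{(m)})$, such that $S^{(j)}=f_j(X^{(j)},U^{(j)})$ and $\mathbb{E}_0|S^{(j)}|\le M$ for some $M>0$, $j=1,\dots,m$. (A2) There exist $L,p,q>0$ such that for all $s,s'\in\mathbb{R}^m$, $|C_m(s)-C_m(s')|\le L\big(\sum_{j=1}^m|s_j-s_j'|^p\big)^q$. (A3) There exists a strictly decreasing function $\alpha\mapsto\kappa_\alpha$ such that $T_\alpha=\mathbf{1}\{C_m(S^{(1)},\dots,S^{(m)})\ge\kappa_\alpha\}$ satisfies $\mathbb{P}_0(T_\alpha=1)\le\alpha$.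
   Context: Model: for $n,m,d\in\mathbb{N}$ and unknown $f\in\mathbb{R}^d$, one observes $X^{(j)}=f+\frac{1}{\sqrt n}Z^{(j)}$, with $Z^{(j)}$ i.i.d. $N(0,I_d)$, $j=1,\dots,m$. $\mathbb{P}_f$ and $\mathbb{E}_f$ denote the joint law (including any auxiliary randomness, whose law does not depend on $f$) and expectation; $\mathbb{P}_0,\mathbb{E}_0$ correspond to $f=0$. For $\rho>0$, $H_\rho=\{f\in\mathbb{R}^d:\|f\|_2\ge\rho\}$; the null hypothesis is $f=0$. Notation: $a\wedge b=\min(a,b)$. *)

(* Defs.v *)
From HB Require Import structures.
From mathcomp Require Import all_boot all_order all_algebra.
From mathcomp Require Import all_classical all_reals all_analysis.
From mathcomp Require Import measurable_realfun.

Set Implicit Arguments.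
Unset Strict Implicit.
Unset Printing Implicit Defensive.

Import Order.TTheory GRing.Theory Num.Theory.
Import numFieldNormedType.Exports.

Local Open Scope classical_set_scope.
Local Open Scope ring_scope.

Section product_law.
Context d (T : measurableType d) (R : realType).

Definition tcons k (x : T * k.-tuple T) : k.+1.-tuple T :=
  [the k.+1.-tuple T of x.1 :: x.2].

Lemma measurable_tcons k : measurable_fun [set: T * k.-tuple T] (@tcons k).
Proof.
by apply: measurable_cons; [exact: measurable_fst|exact: measurable_snd].
Qed.

HB.instance Definition _ k :=
  isMeasurableFun.Build _ _ _ _ (@tcons k) (@measurable_tcons k).

(* The joint law of k independent variables, the i-th one having law mu i. *)
Fixpoint product_law k :
    ('I_k -> probability T R) -> probability (k.-tuple T) R :=
  match k with
  | 0 => fun=> \d_ ([tuple] : 0.-tuple T)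
  | k'.+1 => fun mu =>
      distribution
        (mu ord0 \x product_law (fun i => mu (lift ord0 i)))%E (@tcons k')
  end.

Lemma measurable_box k (A : 'I_k -> set T) : (forall i, measurable (A i)) ->
  measurable [set x : k.-tuple T | forall i, A i (tnth x i)].
Proof.
move=> mA.
rewrite (_ : mkset _ = \big[setI/setT]_(i < k) ((@tnth _ T)^~ i @^-1` A i)).
  apply: bigsetI_measurable => i _; rewrite -[X in measurable X]setTI.
  exact: measurable_tnth.
rewrite -bigcap_seq; apply/seteqP; split => x /= xA i; first by move=> _; exact: xA.
by apply: xA; rewrite /= mem_index_enum.
Qed.

Lemma product_law_box k (mu : 'I_k -> probability T R) (A : 'I_k -> set T) :
  (forall i, measurable (A i)) ->
  product_law mu [set x | forall i, A i (tnth x i)]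
  = (\prod_(i < k) mu i (A i))%E.
Proof.
elim: k mu A => [|k IHk] mu A mA.
  by rewrite /= big_ord0 diracE mem_set//= => -[].
rewrite /= /distribution /pushforward.
rewrite (_ : _ @^-1` _ =
    A ord0 `*` [set x | forall i, A (lift ord0 i) (tnth x i)]).
  rewrite product_measure1E//; last first.
    exact: (@measurable_box k (fun i => A (lift ord0 i))).
  by rewrite big_ord_recl -(IHk _ (fun i => A (lift ord0 i))).
apply/seteqP; split => -[x0 x] /=.
  move=> xA; split=> [|i]; first exact: (xA ord0).
  by have := xA (lift ord0 i); rewrite tnthS.
by move=> [xA0 xA] i; case: (unliftP ord0 i) => [j|] -> //; rewrite tnthS.
Qed.

End product_law.

Section model.
Context {R : realType}.

Definition l2norm d (f : d.-tuple R) : R :=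
  Num.sqrt (\sum_(i < d) tnth f i ^+ 2).

Definition zero_vec d : d.-tuple R := [tuple 0 | i < d].

Definition H_alt d (rho : R) : set (d.-tuple R) := [set f | rho <= l2norm f].

(* normal_prob lives on measurableTypeR R, which has the same measurable sets
   as R but a different display; std_normal is N(0, 1) transported to R along
   the identity.  The second argument of normal_prob is the standard
   deviation. *)
Definition id_measurableTypeR (x : measurableTypeR R) : R := x.

Lemma measurable_id_measurableTypeR :
  measurable_fun [set: measurableTypeR R] id_measurableTypeR.
Proof. exact: measurable_id. Qed.

HB.instance Definition _ := isMeasurableFun.Build _ _ _ _
  id_measurableTypeR measurable_id_measurableTypeR.

Definition std_normal : probability R R :=
  distribution (normal_prob 0 1) id_measurableTypeR.

Lemma std_normalE (A : set R) : std_normal A = normal_prob 0 1 A.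
Proof. by []. Qed.

Definition std_gauss d : probability (d.-tuple R) R :=
  product_law (fun _ : 'I_d => std_normal).

Definition observe n m d (f : d.-tuple R)
    (w : m.-tuple (d.-tuple R) * m.-tuple R) :
    m.-tuple (d.-tuple R) * m.-tuple R :=
  ([tuple [tuple tnth f i + (Num.sqrt n%:R)^-1 * tnth (tnth w.1 j) i | i < d]
   | j < m], w.2).

Lemma measurable_observe n m d (f : d.-tuple R) :
  measurable_fun [set: m.-tuple (d.-tuple R) * m.-tuple R] (observe n f).
Proof.
apply: measurable_fun_pair => //=.
apply/measurable_fun_tnthP => j; apply/measurable_fun_tnthP => i /=.
under [X in measurable_fun _ X]eq_fun do rewrite /= !tnth_mktuple.
apply: measurable_funD => //; apply: measurable_funM => //.
apply: (measurableT_comp (measurable_tnth i)).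
exact: (measurableT_comp (measurable_tnth j)).
Qed.

HB.instance Definition _ n m d (f : d.-tuple R) :=
  isMeasurableFun.Build _ _ _ _ (observe n f) (@measurable_observe n m d f).

(* The random variables U_j enter only through their laws aux_law j: together
   with independence, these determine every P_f. *)
Record statistics m d := Statistics {
  stat_fun : 'I_m -> d.-tuple R * R -> R;
  aux_law : 'I_m -> probability R R }.

(* P_f: the law of (X, U), where X_j = f + Z_j / sqrt n with Z_j i.i.d.
   N(0, I_d), and the U_j are independent of each other and of the Z_j, with
   U_j of law aux_law S j. *)
Definition prob n m d (S : statistics m d) (f : d.-tuple R) :
    probability (m.-tuple (d.-tuple R) * m.-tuple R)%type R :=
  distribution
    (product_law (fun _ : 'I_m => std_gauss d) \x product_law (aux_law S))%E
    (observe n f).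

Definition stat m d (S : statistics m d) (j : 'I_m)
    (w : m.-tuple (d.-tuple R) * m.-tuple R) : R :=
  stat_fun S j (tnth w.1 j, tnth w.2 j).

Definition comb_test m d (S : statistics m d) (C : m.-tuple R -> R) (kappa : R)
    (w : m.-tuple (d.-tuple R) * m.-tuple R) : bool :=
  kappa <= C [tuple stat S j w | j < m].

Definition condA1 n m d (S : statistics m d) (M : R) : Prop :=
  forall j : 'I_m,
    measurable_fun [set: d.-tuple R * R] (stat_fun S j) /\
    ('E_(prob n S (zero_vec d))[fun w => `|stat S j w|%R] <= M%:E)%E.

Definition condA2 m (C : m.-tuple R -> R) (L p q : R) : Prop :=
  forall s s' : m.-tuple R,
    `|C s - C s'| <=
    L * (\sum_(j < m) `|tnth s j - tnth s' j| `^ p) `^ q.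

Definition condA3 n m d (S : statistics m d) (C : m.-tuple R -> R)
    (kappa : R -> R) : Prop :=
  (forall a b : R, 0 < a -> a < b -> b < 1 -> kappa b < kappa a) /\
  (forall a : R, 0 < a < 1 ->
    (prob n S (zero_vec d) [set w | comb_test S C (kappa a) w = true]
      <= a%:E)%E).

End model.
Arguments statistics : clear implicits.
Arguments H_alt {R} d rho.
Arguments zero_vec {R} d.

(* Main.v *)
Require Import Defs.
From mathcomp Require Import all_boot all_order all_algebra.
From mathcomp Require Import all_classical all_reals all_analysis.
From mathcomp Require Import measurable_realfun ring lra.
Import Order.TTheory GRing.Theory Num.Theory.
Import numFieldNormedType.Exports.
Local Open Scope classical_set_scope.
Local Open Scope ring_scope.
Set Implicit Arguments.
Unset Strict Implicit.
Unset Printing Implicit Defensive.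

(** Two tests are combined.  If sqrt m <= d, machine j sends its normalised chi-square statistic
    (n |X_j|^2 - d v) / sqrt d and C_m is their sum over sqrt m.  If sqrt m > d, machine j sends the single
    coordinate sqrt n X_j(i) with i = j mod d, and C_m is the Euclidean norm of the d normalised
    group sums; taking the norm rather than its square makes C_m 1-Lipschitz for the Euclidean
    norm of s, which is (A2) with L = 1, p = 2, q = 1/2 in both cases.  Either test rejects when
    B + L + V >= tau sqrt D, where B >= 0 is the signal, L is linear in the noise with second
    moment at most 4 v B, V is a centered quadratic form of second moment at most w D, and D is
    m d or d; level and power both follow from Chebyshev's inequality. *)

(** * Centered variables with bounded second moment *)

Section second_moment.
Context {R : realType} {d} {T : measurableType d} (P : probability T R).
Implicit Types (f g : T -> R) (a b v : R).

Lemma sq_integrable f v : measurable_fun [set: T] f ->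
  (\int[P]_x (f x ^+ 2)%:E <= v%:E)%E ->
  P.-integrable [set: T] (fun x => (f x ^+ 2)%:E).
Proof.
move=> mf fv; apply/integrableP; split.
  by apply/measurable_EFinP; exact: measurable_funX.
under eq_integral do rewrite /= ger0_norm ?sqr_ge0//.
exact: le_lt_trans fv (ltry _).
Qed.

(** The squares of [f + g] and [f - g] are nonnegative, so [|f g|] is dominated by
    [f ^+ 2 + g ^+ 2]. *)
Lemma mul_integrable f g a b :
  measurable_fun [set: T] f -> measurable_fun [set: T] g ->
  (\int[P]_x (f x ^+ 2)%:E <= a%:E)%E -> (\int[P]_x (g x ^+ 2)%:E <= b%:E)%E ->
  P.-integrable [set: T] (fun x => (f x * g x)%:E).
Proof.
move=> mf mg fa gb.
apply: (@le_integrable _ _ _ _ _ _ _ (fun x => (f x ^+ 2)%:E + (g x ^+ 2)%:E)%E) => //.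
- by apply/measurable_EFinP; exact: measurable_funM.
- move=> x _ /=; rewrite lee_fin ler_norml.
  have := sqr_ge0 (f x + g x); have := sqr_ge0 (f x - g x).
  have := sqr_ge0 (f x); have := sqr_ge0 (g x).
  rewrite (ger0_norm (addr_ge0 (sqr_ge0 _) (sqr_ge0 _))).
  by move=> *; apply/andP; split; nra.
- by apply: integrableD => //; [exact: sq_integrable fa|exact: sq_integrable gb].
Qed.

Lemma integrable_of_sq f v : measurable_fun [set: T] f ->
  (\int[P]_x (f x ^+ 2)%:E <= v%:E)%E ->
  P.-integrable [set: T] (fun x => (f x)%:E).
Proof.
move=> mf fv.
rewrite [X in P.-integrable _ X](_ : _ = fun x => (f x * cst 1 x)%:E); last first.
  by apply/funext => x; rewrite mulr1.
apply: (@mul_integrable _ _ v 1) => //; under eq_integral do rewrite expr1n.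
by rewrite integral_cst//= probability_setT mule1.
Qed.

(** [v] is only an upper bound for the variance: this is all that Chebyshev's inequality uses, and
    such bounds can be relaxed freely. It also makes [f] integrable, so that the zero mean is
    meaningful. *)
Definition centered f v := [/\ measurable_fun [set: T] f,
  (\int[P]_x (f x ^+ 2)%:E <= v%:E)%E & (\int[P]_x (f x)%:E = 0)%E].

Lemma centered_le f a b : a <= b -> centered f a -> centered f b.
Proof.
by move=> ab [mf fa f0]; split=> //; rewrite (le_trans fa)// lee_fin.
Qed.

Lemma centered0 : centered (cst 0) 0.
Proof.
split; first exact: measurable_cst.
  by rewrite (_ : (fun _ => _) = cst 0%E) ?integral0//; apply/funext => x /=; rewrite expr0n.
by rewrite integral0.
Qed.

Lemma centeredZ f v (k : R) : centered f v -> centered (fun x => k * f x) (k ^+ 2 * v).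
Proof.
move=> [mf fv f0]; split; first exact: measurable_funM.
- under eq_integral => x _ do rewrite exprMn (EFinM (k ^+ 2)).
  rewrite ge0_integralZl//=.
  + by rewrite [leRHS]EFinM lee_wpmul2l// lee_fin sqr_ge0.
  + by apply/measurable_EFinP; exact: measurable_funX.
  + by move=> x _; rewrite lee_fin sqr_ge0.
  + by rewrite lee_fin sqr_ge0.
- under eq_integral do rewrite EFinM.
  rewrite integralZl//=; first by rewrite f0 mule0.
  exact: integrable_of_sq fv.
Qed.

(** Chebyshev's inequality: on the event, [t ^+ 2 <= f ^+ 2], and enlarging the domain of
    integration only adds nonnegative mass. *)
Lemma centered_markov f v (t : R) : 0 < t -> centered f v ->
  (P [set x | (t <= `|f x|)%R] <= (v / t ^+ 2)%R%:E)%E.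
Proof.
move=> t0 [mf fv _].
rewrite EFinM muleC lee_pdivlMl ?exprn_gt0//.
apply: le_trans fv.
have mA : measurable [set x | t <= `|f x|].
  rewrite -[X in measurable X]setTI.
  by apply: measurable_fun_le => //; exact: measurableT_comp.
apply: (@le_trans _ _ (\int[P]_(x in [set x | (t <= `|f x|)%R]) ((t ^+ 2)%:E)%E)%E).
  by rewrite integral_cst.
apply: (@le_trans _ _ (\int[P]_(x in [set x | (t <= `|f x|)%R]) ((f x ^+ 2)%:E)%E)%E).
  apply: ge0_le_integral => //.
  - by move=> x _; rewrite lee_fin sqr_ge0.
  - by apply/measurable_EFinP/measurable_funTS; exact: measurable_funX.
  - by move=> x /= tx; rewrite lee_fin -[leRHS]real_normK ?num_real// lerXn2r ?nnegrE// ltW.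
apply: ge0_subset_integral => //.
- by apply/measurable_EFinP; exact: measurable_funX.
- by move=> x _; rewrite lee_fin sqr_ge0.
Qed.

(** Pointwise [|f| <= 1 + f ^+ 2]. This turns second moments into the first-moment bound of (A1). *)
Lemma integral_norm_le f v : measurable_fun [set: T] f ->
  (\int[P]_x (f x ^+ 2)%:E <= v%:E)%E ->
  (\int[P]_x `|f x|%:E <= (1 + v)%R%:E)%E.
Proof.
move=> mf fv; apply: (@le_trans _ _ (\int[P]_x (1 + (f x ^+ 2)%:E))%E).
  apply: ge0_le_integral => //.
  - by apply/measurable_EFinP; exact: measurableT_comp.
  - apply: emeasurable_funD => //; apply/measurable_EFinP; exact: measurable_funX.
  - move=> x _; rewrite lee_fin -[X in _ + X]real_normK ?num_real//.
    have := sqr_ge0 (`|f x| - 1); have := normr_ge0 (f x); nra.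
rewrite ge0_integralD//.
- by rewrite integral_cst//= probability_setT mule1 EFinD leeD2l.
- by move=> x _; rewrite lee_fin sqr_ge0.
- by apply/measurable_EFinP; exact: measurable_funX.
Qed.

(** From [(x + y) ^+ 2 <= 2 x ^+ 2 + 2 y ^+ 2]; the factor 2 is the price for allowing [f] and [g]
    to be dependent. *)
Lemma centered_comb f g a b (k l : R) : centered f a -> centered g b ->
  centered (fun x => k * f x + l * g x) (2 * (k ^+ 2 * a) + 2 * (l ^+ 2 * b)).
Proof.
move=> /(centeredZ k)[mf fa f0] /(centeredZ l)[mg gb g0].
have if2 := sq_integrable mf fa; have ig2 := sq_integrable mg gb.
split; first exact: measurable_funD.
- apply: (@le_trans _ _ (\int[P]_x (2%:E * ((k * f x) ^+ 2)%:E + 2%:E * ((l * g x) ^+ 2)%:E))%E).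
    apply: ge0_le_integral => //.
    + by move=> x _; rewrite lee_fin sqr_ge0.
    + by apply/measurable_EFinP/measurable_funX; exact: measurable_funD.
    + apply: emeasurable_funD; apply: emeasurable_funM => //;
        apply/measurable_EFinP; exact: measurable_funX.
    + move=> x _; rewrite -!EFinM -EFinD lee_fin.
      have := sqr_ge0 (k * f x - l * g x); nra.
  rewrite integralD//=; [|exact: integrableZl..].
  by rewrite !integralZl//= [leRHS]EFinD; apply: leeD; rewrite [leRHS]EFinM lee_wpmul2l.
- under eq_integral do rewrite EFinD.
  rewrite integralD//=; first by rewrite f0 g0 adde0.
  + exact: integrable_of_sq fa.
  + exact: integrable_of_sq gb.
Qed.

End second_moment.

Lemma centered_distribution {R : realType} {d1 d2} {T1 : measurableType d1}
    {T2 : measurableType d2} (P : probability T1 R) (X : {mfun T1 >-> T2})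
    (f : T2 -> R) v :
  measurable_fun [set: T2] f -> centered P (f \o X) v ->
  centered (distribution P X) f v.
Proof.
move=> mf [mfX fv f0]; split=> //.
- rewrite ge0_integral_distribution//.
    by apply/measurable_EFinP; exact: measurable_funX.
  by move=> x; rewrite lee_fin sqr_ge0.
- rewrite integral_distribution//; first exact/measurable_EFinP.
  exact: (integrable_of_sq mfX fv).
Qed.

(** * Centered variables on a product of two probability spaces *)

Section product.
Context {R : realType} {d1 d2} {T1 : measurableType d1} {T2 : measurableType d2}.
Variables (P : probability T1 R) (Q : probability T2 R).

Lemma ge0_integral_fst (f : T1 -> R) : measurable_fun [set: T1] f ->
  (forall x, 0 <= f x) -> (\int[P \x Q]_z (f z.1)%:E = \int[P]_x (f x)%:E)%E.
Proof.
move=> mf f0; rewrite fubini_tonelli1//=.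
- apply: eq_integral => x _; rewrite /fubini_F /=.
  by rewrite integral_cst//= probability_setT mule1.
- by apply/measurable_EFinP; exact: (measurableT_comp mf measurable_fst).
- by move=> x; rewrite lee_fin.
Qed.

Lemma ge0_integral_snd (f : T2 -> R) : measurable_fun [set: T2] f ->
  (forall x, 0 <= f x) -> (\int[P \x Q]_z (f z.2)%:E = \int[Q]_x (f x)%:E)%E.
Proof.
move=> mf f0; rewrite fubini_tonelli2//=.
- apply: eq_integral => x _; rewrite /fubini_G /=.
  by rewrite integral_cst//= probability_setT mule1.
- by apply/measurable_EFinP; exact: (measurableT_comp mf measurable_snd).
- by move=> x; rewrite lee_fin.
Qed.

Lemma centered_fst (f : T1 -> R) v : centered P f v ->
  centered (P \x Q)%E (fun z => f z.1) v.
Proof.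
move=> [mf fv f0].
have mf1 : measurable_fun [set: T1 * T2] (fun z => f z.1).
  exact: (measurableT_comp mf measurable_fst).
have fv1 : (\int[P \x Q]_z (f z.1 ^+ 2)%:E <= v%:E)%E.
  rewrite (@ge0_integral_fst (fun x => f x ^+ 2))// => [|x]; last exact: sqr_ge0.
  exact: measurable_funX.
split=> //; rewrite -integral12_prod_meas1/=; last exact: integrable_of_sq fv1.
rewrite -[RHS]f0; apply: eq_integral => x _; rewrite /fubini_F /=.
by rewrite integral_cst//= probability_setT mule1.
Qed.

(** By independence the second moments multiply (Tonelli), and the mean vanishes when [f] is
    integrated first (Fubini). *)
Lemma centered_mul (f : T1 -> R) (g : T2 -> R) a b :
  centered P f a -> centered Q g b ->
  centered (P \x Q)%E (fun z => g z.2 * f z.1) (a * b).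
Proof.
move=> [mf fa f0] [mg gb _].
have mfg : measurable_fun [set: T1 * T2] (fun z => g z.2 * f z.1).
  apply: measurable_funM; first exact: (measurableT_comp mg measurable_snd).
  exact: (measurableT_comp mf measurable_fst).
have f2 : (0 <= \int[P]_x (f x ^+ 2)%:E)%E.
  by apply: integral_ge0 => x _; rewrite lee_fin sqr_ge0.
have fgab : (\int[P \x Q]_z ((g z.2 * f z.1) ^+ 2)%:E <= (a * b)%R%:E)%E.
  rewrite fubini_tonelli2//=; last 2 first.
  - by apply/measurable_EFinP/measurable_funX.
  - by move=> z; rewrite lee_fin sqr_ge0.
  rewrite (_ : (\int[_]_x _)%E =
      (\int[Q]_y ((g y ^+ 2)%:E * (\int[P]_x (f x ^+ 2)%:E)))%E); last first.
    apply: eq_integral => y _; rewrite /fubini_G /=.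
    under eq_integral do rewrite exprMn (EFinM (_ ^+ 2)).
    rewrite ge0_integralZl//=; last 2 first.
    - by move=> x _; rewrite lee_fin sqr_ge0.
    - by rewrite lee_fin sqr_ge0.
    by apply/measurable_EFinP; exact: measurable_funX.
  rewrite ge0_integralZr//=; last 2 first.
  - by apply/measurable_EFinP; exact: measurable_funX.
  - by move=> y _; rewrite lee_fin sqr_ge0.
  rewrite muleC EFinM lee_pmul//.
  by apply: integral_ge0 => x _; rewrite lee_fin sqr_ge0.
split=> //; rewrite -integral21_prod_meas1/=; last exact: integrable_of_sq fgab.
apply: integral0_eq => y _; rewrite /fubini_G /=.
under eq_integral do rewrite EFinM.
by rewrite integralZl//= ?f0 ?mule0//; exact: integrable_of_sq fa.
Qed.

(* [G] is a martingale increment: given the second coordinate, its mean over the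
   first one vanishes, so the cross term in the square integrates to 0. *)
Lemma centered_increment (V : T2 -> R) (G : T1 * T2 -> R) a b :
  centered Q V a -> measurable_fun [set: T1 * T2] G ->
  (\int[P \x Q]_z (G z ^+ 2)%:E <= b%:E)%E ->
  (forall y, P.-integrable [set: T1] (fun x => (G (x, y))%:E)) ->
  (forall y, \int[P]_x (G (x, y))%:E = 0)%E ->
  centered (P \x Q)%E (fun z => V z.2 + G z) (a + b).
Proof.
move=> [mV Va V0] mG Gb iGy G0.
have mV2 : measurable_fun [set: T1 * T2] (fun z => V z.2).
  exact: (measurableT_comp mV measurable_snd).
have Va2 : (\int[P \x Q]_z (V z.2 ^+ 2)%:E <= a%:E)%E.
  rewrite (@ge0_integral_snd (fun x => V x ^+ 2))// => [|x]; last exact: sqr_ge0.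
  exact: measurable_funX.
have iV : (P \x Q)%E.-integrable [set: T1 * T2] (fun z => (V z.2)%:E).
  exact: integrable_of_sq Va2.
have iG : (P \x Q)%E.-integrable [set: T1 * T2] (fun z => (G z)%:E).
  exact: integrable_of_sq Gb.
have iVG : (P \x Q)%E.-integrable [set: T1 * T2] (fun z => (V z.2 * G z)%:E).
  exact: mul_integrable Va2 Gb.
have GV0 : (\int[P \x Q]_z (V z.2 * G z)%:E = 0)%E.
  rewrite -integral21_prod_meas1//=.
  apply: integral0_eq => y _; rewrite /fubini_G /=.
  under eq_integral do rewrite EFinM.
  by rewrite integralZl//= G0 mule0.
split.
- exact: measurable_funD.
- under eq_integral do rewrite sqrrD.
  rewrite (_ : (\int[_]_x _)%E =
      (\int[P \x Q]_z ((V z.2 ^+ 2)%:E + (V z.2 * G z)%:E + (V z.2 * G z)%:E +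
        (G z ^+ 2)%:E))%E); last first.
    by apply: eq_integral => z _; rewrite -!EFinD mulr2n !addrA.
  have iV2 := sq_integrable mV2 Va2.
  have iG2 := sq_integrable mG Gb.
  rewrite integralD//=; last by do 2 apply: integrableD => //.
  rewrite integralD//=; last by apply: integrableD.
  by rewrite integralD//= GV0 !adde0 EFinD leeD.
- under eq_integral do rewrite EFinD.
  rewrite integralD//= -!integral21_prod_meas1//=.
  rewrite [X in (_ + X)%E]integral0_eq; last by move=> y _; exact: G0.
  rewrite adde0 -[RHS]V0; apply: eq_integral => y _; rewrite /fubini_G /=.
  by rewrite integral_cst//= probability_setT mule1.
Qed.
End product.

(** * Sums and quadratic forms of independent coordinates *)

Section product_law.
Context {R : realType} {d} {T : measurableType d}.

Lemma measurable_sum_tnth k (r : seq 'I_k) (p : pred 'I_k) (g : 'I_k -> T -> R) :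
  (forall j, measurable_fun [set: T] (g j)) ->
  measurable_fun [set: k.-tuple T] (fun x => \sum_(j <- r | p j) g j (tnth x j)).
Proof.
move=> mg; under eq_fun do rewrite big_mkcond.
apply: measurable_sum => j; case: (p j) => //.
by apply: measurableT_comp => //; exact: measurable_tnth.
Qed.

Lemma tnth_tcons0 k (z : T * k.-tuple T) : tnth (tcons z) ord0 = z.1.
Proof. by []. Qed.

Lemma tnth_tconsS k (z : T * k.-tuple T) j : tnth (tcons z) (lift ord0 j) = tnth z.2 j.
Proof. by rewrite tnthS. Qed.

Lemma centered_product_lawS k (mu : 'I_k.+1 -> probability T R)
    (f : k.+1.-tuple T -> R) v :
  measurable_fun [set: k.+1.-tuple T] f ->
  centered (mu ord0 \x product_law (fun i => mu (lift ord0 i)))%E (f \o @tcons _ T k) v ->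
  centered (product_law mu) f v.
Proof. exact: centered_distribution. Qed.

(** Variances of independent variables add. By induction on [k]: the term of the head coordinate is
    a martingale increment over the sum of the others. *)
Lemma centered_sum k (mu : 'I_k -> probability T R) (g : 'I_k -> T -> R)
    (v : 'I_k -> R) :
  (forall j, centered (mu j) (g j) (v j)) ->
  centered (product_law mu) (fun x => \sum_(j < k) g j (tnth x j)) (\sum_(j < k) v j).
Proof.
elim: k mu g v => [|k IHk] mu g v cg.
  rewrite big_ord0.
  rewrite (_ : (fun _ => _) = cst 0); first exact: centered0.
  by apply/funext => x; rewrite big_ord0.
apply: centered_product_lawS.
  by apply: measurable_sum_tnth => j; case: (cg j).
rewrite (_ : _ \o _ = fun z => \sum_(j < k) g (lift ord0 j) (tnth z.2 j) + g ord0 z.1); last first.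
  apply/funext => z /=; rewrite big_ord_recl addrC tnth_tcons0; congr (_ + _).
  by apply: eq_bigr => j _; rewrite tnth_tconsS.
rewrite big_ord_recl addrC.
have [mg0 gv0 g00] := cg ord0.
apply: (@centered_increment _ _ _ _ _ _ _
  (fun y => \sum_(j < k) g (lift ord0 j) (tnth y j)) (fun z => g ord0 z.1)) => //.
- exact: (IHk _ (fun j => g (lift ord0 j)) (fun j => v (lift ord0 j))).
- exact: (measurableT_comp mg0 measurable_fst).
- rewrite (@ge0_integral_fst _ _ _ _ _ _ _ (fun x => g ord0 x ^+ 2))// => [|x].
    exact: measurable_funX.
  exact: sqr_ge0.
- by move=> y /=; exact: integrable_of_sq gv0.
Qed.

(** The case of [centered_sum] in which every other term is the zero function. *)
Lemma centered_tnth k (mu : 'I_k -> probability T R) (j : 'I_k) (g : T -> R) v :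
  centered (mu j) g v -> centered (product_law mu) (fun x => g (tnth x j)) v.
Proof.
move=> cg.
have := @centered_sum k mu (fun i => if i == j then g else cst 0)
   (fun i => if i == j then v else 0).
rewrite -big_mkcond big_pred1_eq (_ : (fun _ => _) = fun x => g (tnth x j)).
  by apply=> i; case: eqP => [->//|_]; exact: centered0.
apply/funext => x; rewrite (bigD1 j)//= eqxx big1 ?addr0// => i /negbTE.
by move=> ->.
Qed.

(* Second moments of a diagonal quadratic form, by revealing the coordinates one at a time:
   adding [z] to the group sum [A] changes [A^2 - v n] by the martingale increment
   [2 A z + (z^2 - v)], of second moment at most [8 v^2 n + 2 K]. *)
Lemma centered_group_squares k e (c : 'I_k -> 'I_e) (w : 'I_e -> R)
    (mu : 'I_k -> probability T R) (h : 'I_k -> T -> R) (v K : R) :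
  0 <= v ->
  (forall j, centered (mu j) (h j) v) ->
  (forall j, centered (mu j) (fun x => h j x ^+ 2 - v) K) ->
  centered (product_law mu)
    (fun x => \sum_(i < e) w i * ((\sum_(j < k | c j == i) h j (tnth x j)) ^+ 2
                                  - v * (\sum_(j < k | c j == i) 1)))
    (\sum_(i < e) w i ^+ 2 * (\sum_(j < k | c j == i) 1) ^+ 2 * (4 * v ^+ 2 + 2 * K)).
Proof.
move=> v0; elim: k c mu h => [|k IHk] c mu h ch cq.
  rewrite big1 => [|i _]; last by rewrite big_ord0 expr0n/= mulr0 mul0r.
  rewrite (_ : (fun _ => _) = cst 0); first exact: centered0.
  by apply/funext => x; rewrite big1// => i _; rewrite !big_ord0 expr0n/= mulr0 subrr mulr0.
have [mh hv h0] := ch ord0; have [mq qK q0] := cq ord0.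
(* Group sums [A] and group sizes [n] before the head coordinate is revealed; only its own group
   [i0] will change. *)
pose A i (y : k.-tuple T) := \sum_(j < k | c (lift ord0 j) == i) h (lift ord0 j) (tnth y j).
pose n i := \sum_(j < k | c (lift ord0 j) == i) 1 : R.
pose i0 := c ord0.
pose nu := product_law (fun j => mu (lift ord0 j)).
have cA : centered nu (A i0) (v * n i0).
  rewrite (_ : v * n i0 = \sum_(j < k) if c (lift ord0 j) == i0 then v else 0); last first.
    by rewrite mulr_sumr big_mkcond; apply: eq_bigr => j _; rewrite mulr1.
  rewrite (_ : A i0 = fun y => \sum_(j < k)
      (if c (lift ord0 j) == i0 then h (lift ord0 j) else cst 0) (tnth y j)); last first.
    by apply/funext => y; rewrite /A big_mkcond; apply: eq_bigr => j _; case: ifP.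
  apply: (@centered_sum k _ (fun j => if c (lift ord0 j) == i0 then h (lift ord0 j) else cst 0)
    (fun j => if c (lift ord0 j) == i0 then v else 0)) => j.
  by case: ifP => // _; exact: centered0.
have [mA A2 _] := cA.
pose V y := \sum_(i < e) w i * (A i y ^+ 2 - v * n i).
pose G z := w i0 * 2 * A i0 z.2 * h ord0 z.1 + w i0 * (h ord0 z.1 ^+ 2 - v).
(* The two parts of the increment are a product of independent centered variables and a function of
   the head alone; [centered_comb] joins them, whence the factors 2. *)
have cG : centered (mu ord0 \x nu)%E G
    (2 * ((w i0 * 2) ^+ 2 * (v * (v * n i0))) + 2 * (w i0 ^+ 2 * K)).
  have := centered_comb (w i0 * 2) (w i0)
    (centered_mul (ch ord0) cA) (centered_fst nu (cq ord0)).
  by congr centered; apply/funext => z; rewrite /G mulrA.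
have split0 (F : 'I_k.+1 -> R) i : \sum_(j < k.+1 | c j == i) F j =
    (if i0 == i then F ord0 else 0) + \sum_(j < k | c (lift ord0 j) == i) F (lift ord0 j).
  by rewrite big_mkcond big_ord_recl -big_mkcond.
(* Writing what concerns [i0] as a sum over all groups makes the identity and the bound below
   termwise. *)
have pick0 (F : 'I_e -> R) : F i0 = \sum_(i < e) if i0 == i then F i else 0.
  by rewrite -big_mkcond (big_pred1 i0)// => i; rewrite eq_sym.
apply: centered_product_lawS.
  apply: measurable_sum => i; apply: measurable_funM => //; apply: measurable_funB => //.
  by apply: measurable_funX; apply: measurable_sum_tnth => j; case: (ch j).
rewrite (_ : _ \o _ = fun z => V z.2 + G z); last first.
  apply/funext => z /=.
  rewrite /G (pick0 (fun i => w i * 2 * A i z.2 * h ord0 z.1 + w i * (h ord0 z.1 ^+ 2 - v))).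
  rewrite -big_split/=; apply: eq_bigr => i _; rewrite !split0 tnth_tcons0.
  under eq_bigr do rewrite tnth_tconsS.
  by rewrite -/(A i z.2) -/(n i); case: eqP => _; ring.
have K0 : 0 <= K.
  rewrite -lee_fin (le_trans _ qK)//; apply: integral_ge0 => x _.
  by rewrite lee_fin sqr_ge0.
have n0 i : 0 <= n i by apply: sumr_ge0.
(* In group [i0] the size grows from [n] to [1 + n], and [(1 + n) ^+ 2 - n ^+ 2 = 1 + 2 n] times
   [4 v ^+ 2 + 2 K] exceeds [8 v ^+ 2 n + 2 K] by [4 (v ^+ 2 + n K)], which is nonnegative. *)
apply: (@centered_le _ _ _ _ _ (\sum_(i < e) w i ^+ 2 * n i ^+ 2 * (4 * v ^+ 2 + 2 * K)
    + (2 * ((w i0 * 2) ^+ 2 * (v * (v * n i0))) + 2 * (w i0 ^+ 2 * K)))).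
  rewrite (pick0 (fun i => 2 * ((w i * 2) ^+ 2 * (v * (v * n i))) + 2 * (w i ^+ 2 * K))).
  rewrite -big_split/=; apply: ler_sum => i _; rewrite split0 -/(n i).
  case: eqP => _; last by rewrite add0r addr0.
  have := mulr_ge0 (sqr_ge0 (w i)) (addr_ge0 (sqr_ge0 v) (mulr_ge0 (n0 i) K0)).
  by move: (w i) (n i) => a b; nra.
apply: (@centered_increment _ _ _ _ _ _ _ V G).
- exact: (IHk (fun j => c (lift ord0 j)) _ (fun j => h (lift ord0 j))).
- by have [] := cG.
- by have [] := cG.
- move=> y.
  have [mc cv _] := centered_comb (w i0 * 2 * A i0 y) (w i0) (ch ord0) (cq ord0).
  exact: integrable_of_sq cv.
- move=> y.
  by have [] := centered_comb (w i0 * 2 * A i0 y) (w i0) (ch ord0) (cq ord0).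
Qed.
End product_law.

(** * Moments of the standard normal law *)

Section density.
Local Open Scope ereal_scope.
Context {R : realType} {d} {T : measurableType d}.
Variables (mu nu : {measure set T -> \bar R}) (p : T -> R).
Hypotheses (mp : measurable_fun [set: T] p) (p0 : forall x, (0 <= p x)%R).
Hypothesis nuE : forall A, measurable A -> nu A = \int[mu]_(x in A) (p x)%:E.

Import HBNNSimple.

(** By linearity it suffices to treat the indicators of the level sets of [h], for which the claim
    is [nuE]. *)
Let integral_density_nnsfun (h : {nnsfun T >-> R}) :
  \int[nu]_x (h x)%:E = \int[mu]_x ((h x)%:E * (p x)%:E).
Proof.
have mp' : measurable_fun [set: T] (EFin \o p) by exact/measurable_EFinP.
under [LHS]eq_integral do rewrite fimfunE -fsumEFin//.
rewrite [LHS]ge0_integral_fsum//; last 2 first.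
  - by move=> r; exact/measurable_EFinP/measurableT_comp.
  - by move=> n x _; rewrite EFinM nnfun_muleindic_ge0.
under [RHS]eq_integral.
  move=> x xD; rewrite fimfunE -fsumEFin// ge0_mule_fsuml; last first.
    by move=> r; rewrite EFinM nnfun_muleindic_ge0.
  over.
rewrite [RHS]ge0_integral_fsum//; last 2 first.
  - move=> r; apply: emeasurable_funM => //.
    by apply/measurable_EFinP; exact: measurableT_comp.
  - move=> n x _; apply: mule_ge0; last by rewrite lee_fin.
    by rewrite EFinM nnfun_muleindic_ge0.
apply: eq_fsbigr => r /[!inE] -[t _ htr].
rewrite integralZl_indic_nnsfun//= integral_indic//= setIT nuE//.
under [RHS]eq_integral do rewrite EFinM -muleA.
rewrite ge0_integralZl//.
- congr (_ * _); rewrite integral_mkcond; apply: eq_integral => x _.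
  by rewrite epatch_indic muleC.
- by apply: emeasurable_funM => //; exact/measurable_EFinP.
- by move=> x _; rewrite mule_ge0// lee_fin.
- by rewrite -htr lee_fin.
Qed.

(** Monotone convergence on both sides along an increasing sequence of simple functions. *)
Lemma ge0_integral_density (f : T -> R) :
  measurable_fun [set: T] f -> (forall x, (0 <= f x)%R) ->
  \int[nu]_x (f x)%:E = \int[mu]_x (f x * p x)%:E.
Proof.
move=> mf f0.
have mf' : measurable_fun [set: T] (EFin \o f) by exact/measurable_EFinP.
have f0' x : [set: T] x -> 0 <= (EFin \o f) x by rewrite lee_fin.
pose h := nnsfun_approx measurableT mf'.
have hf x : (h n x)%:E @[n --> \oo] --> (f x)%:E.
  exact: (cvg_nnsfun_approx measurableT mf' f0').
have nd_h x : {homo (fun n => (h n x)%:E) : a b / (a <= b)%N >-> a <= b}.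
  by move=> a b ab; rewrite lee_fin; exact/lefP/nd_nnsfun_approx.
transitivity (lim ((\int[nu]_x (h n x)%:E) @[n --> \oo])).
  rewrite -monotone_convergence//=.
  - by apply: eq_integral => x _; apply/esym/cvg_lim.
  - by move=> n; exact/measurable_EFinP.
  - by move=> n x _; rewrite lee_fin.
transitivity (lim ((\int[mu]_x ((h n x)%:E * (p x)%:E)) @[n --> \oo])).
  by under eq_fun do rewrite integral_density_nnsfun.
rewrite -monotone_convergence//=.
- apply: eq_integral => x _; apply/cvg_lim => //.
  rewrite EFinM; apply: cvgeZr => //; exact: hf.
- by move=> n; apply: emeasurable_funM; exact/measurable_EFinP.
- by move=> n x _; rewrite mule_ge0 ?lee_fin.
- by move=> x _ a b ab; rewrite lee_wpmul2r ?lee_fin//; exact/lefP/nd_nnsfun_approx.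
Qed.

End density.

Section normal.
Context {R : realType}.
Local Notation mu := (@lebesgue_measure R).
Local Notation phi := (@normal_pdf R 0 1).

Lemma ge0_integral_std_normal (f : R -> R) :
  measurable_fun [set: R] f -> (forall x, 0 <= f x) ->
  (\int[std_normal]_x (f x)%:E = \int[mu]_x (f x * phi x)%:E)%E.
Proof.
move=> mf f0; rewrite ge0_integral_distribution//; last first.
  exact/measurable_EFinP.
apply: ge0_integral_density => //.
  exact: measurable_normal_pdf.
exact: normal_pdf_ge0.
Qed.

(** The function [x ^+ 4 * phi x] is dominated by a multiple of the normal density with standard
    deviation 2, whose integral is 1. *)
Lemma std_normal_fourth :
  exists K : R, (\int[@std_normal R]_x (x ^+ 4)%:E <= K%:E)%E.
Proof.
exists (64 * (normal_peak 1 / normal_peak 2)).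
rewrite ge0_integral_std_normal => [||x]; last 2 first.
- exact: measurable_funX.
- by rewrite exprn_even_ge0.
have p1 : 0 < normal_peak (1 : R) by rewrite normal_peak_gt0.
have p2 : 0 < normal_peak (2 : R) by rewrite normal_peak_gt0.
apply: (@le_trans _ _ (\int[mu]_x ((64 * (normal_peak 1 / normal_peak 2))%:E *
    (normal_pdf 0 2 x)%:E))%E).
  apply: ge0_le_integral => //.
  - by move=> x _; rewrite lee_fin mulr_ge0 ?normal_pdf_ge0// exprn_even_ge0.
  - apply/measurable_EFinP/measurable_funM; first exact: measurable_funX.
    exact: measurable_normal_pdf.
  - apply: emeasurable_funM => //; apply/measurable_EFinP; exact: measurable_normal_pdf.
  - move=> x _; rewrite -EFinM lee_fin !normal_pdfE// /normal_fun subr0.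
    rewrite [leRHS](_ : _ = normal_peak 1 * (64 * expR (- x ^+ 2 / (2 ^+ 2 *+ 2)))); last first.
      by field; rewrite gt_eqF.
    rewrite mulrCA ler_pM2l//.
    (* In this variable the two exponents are [- 4 y] and [- y], and [x ^+ 4 = 64 y ^+ 2]. What
       remains is [y ^+ 2 <= expR (3 y)], which follows from [1 + y <= expR y]. *)
    pose y := x ^+ 2 / 8.
    have y0 : 0 <= y by rewrite divr_ge0// sqr_ge0.
    rewrite (_ : - x ^+ 2 / (2 ^+ 2 *+ 2) = - y); last by rewrite /y; field.
    rewrite (_ : - x ^+ 2 / (1 ^+ 2 *+ 2) = - y + - (y + y + y)); last by rewrite /y; field.
    rewrite (_ : x ^+ 4 = 64 * y ^+ 2); last by rewrite /y; field.
    rewrite expRD -mulrA ler_pM2l// mulrCA ler_piMr ?expR_ge0//.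
    rewrite (expRN (_ + _ + _)) ler_pdivrMr ?expR_gt0// mul1r.
    have := expR_ge1Dx y; rewrite !expRD; move: (expR y) => z; nra.
rewrite ge0_integralZl//.
- by rewrite integral_normal_pdf mule1.
- by apply/measurable_EFinP; exact: measurable_normal_pdf.
- by move=> x _; rewrite lee_fin normal_pdf_ge0.
- by rewrite lee_fin mulr_ge0// divr_ge0// ltW.
Qed.

(** The density is even, so the positive and negative parts of [x] have the same integral; the
    second moment makes it finite, hence they cancel. *)
Lemma std_normal_mean (v : R) : (\int[std_normal]_x (x ^+ 2)%:E <= v%:E)%E ->
  (\int[@std_normal R]_x x%:E = 0)%E.
Proof.
move=> xv.
have ix : (@std_normal R).-integrable setT (fun x : R => x%:E).
  exact: (integrable_of_sq (@measurable_id _ R setT) xv).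
pose G : R -> R := fun x => Num.max (- x) 0 * phi x.
have phiN x : phi (- x) = phi x.
  by rewrite !normal_pdfE ?oner_eq0// /normal_fun !subr0 sqrrN.
have mmax (f : R -> R) : measurable_fun setT f ->
  measurable_fun setT (fun x => Num.max (f x) 0) by move=> mf; exact: measurable_maxr.
have posE : (\int[std_normal]_x ((fun x : R => x%:E)^\+ x) =
    \int[std_normal]_x (Num.max x 0)%:E)%E.
  by apply: eq_integral => x _; rewrite funeposE -fine_max.
have negE : (\int[std_normal]_x ((fun x : R => x%:E)^\- x) =
    \int[std_normal]_x (Num.max (- x) 0)%:E)%E.
  by apply: eq_integral => x _; rewrite funenegE -fine_max.
have max0 (x : R) : 0 <= Num.max x 0 by rewrite le_max lexx orbT.
have G_ge0 x : 0 <= G x by rewrite mulr_ge0 ?normal_pdf_ge0.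
have cG : continuous G.
  move=> x; apply: cvgM; last exact: continuous_normal_pdf.
  apply: (@continuous_max _ _ (fun x : R => - x) (cst 0)).
    exact: oppr_continuous.
  exact: cst_continuous.
have maxE : (\int[@std_normal R]_x (Num.max x 0)%:E =
    \int[@std_normal R]_x (Num.max (- x) 0)%:E)%E.
  rewrite !ge0_integral_std_normal; [ |exact: mmax|by move=> x; exact: max0|
    exact: mmax|by move=> x; exact: max0].
  (* [G] vanishes on the positive half-line, so both integrals live on a half-line and the
     reflection is a change of variables between the two. *)
  transitivity (\int[mu]_(x in `[0%R, +oo[) ((G \o -%R) x)%:E)%E.
    rewrite [RHS]integral_mkcond; apply: eq_integral => x _.
    rewrite patchE mem_setE in_itv/= andbT /G /= opprK phiN.
    by case: leP => // x0; rewrite mul0r.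
  rewrite -ge0_integration_by_substitutionNy ?oppr0//; last exact: continuous_subspaceT.
  rewrite [LHS]integral_mkcond; apply: eq_integral => x _.
  rewrite patchE mem_setE in_itv/=.
  by case: leP => // x0; rewrite max_r ?mul0r// oppr_le0 ltW.
rewrite integralE posE negE maxE subee// -negE.
exact: integrable_neg_fin_num.
Qed.

(* The tests only need these moments to be finite, so their values are not computed. *)
Lemma std_normal_moments : exists v K : R, [/\ 0 <= v, 0 <= K,
  centered (@std_normal R) (fun x => x) v &
  centered (@std_normal R) (fun x => x ^+ 2 - v) K].
Proof.
have [K4 xK4] := std_normal_fourth.
have mX2 : measurable_fun [set: R] (fun x => x ^+ 2) by exact: measurable_funX.
have x4 : (\int[@std_normal R]_x ((x ^+ 2) ^+ 2)%:E <= K4%:E)%E.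
  by under eq_integral do rewrite -exprM.
have ix2 := integrable_of_sq mX2 x4.
pose v := fine (\int[@std_normal R]_x (x ^+ 2)%:E)%E.
have vE : (\int[@std_normal R]_x (x ^+ 2)%:E = v%:E)%E.
  by rewrite fineK//; exact: integrable_fin_num.
have v0 : 0 <= v.
  by rewrite -lee_fin -vE; apply: integral_ge0 => x _; rewrite lee_fin sqr_ge0.
have K40 : 0 <= K4.
  by rewrite -lee_fin (le_trans _ x4)//; apply: integral_ge0 => x _; rewrite lee_fin sqr_ge0.
(* Since [v] and [x ^+ 2] are nonnegative, [(x ^+ 2 - v) ^+ 2 <= x ^+ 4 + v ^+ 2]. *)
exists v, (K4 + v ^+ 2); split=> //.
- by rewrite addr_ge0// sqr_ge0.
- split=> //; first by rewrite vE.
  by apply: (@std_normal_mean v); rewrite vE.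
- split; first exact: measurable_funB.
  + apply: (@le_trans _ _ (\int[@std_normal R]_x (((x ^+ 2) ^+ 2)%:E + (v ^+ 2)%:E))%E).
      apply: ge0_le_integral => //.
      * by move=> x _; rewrite lee_fin sqr_ge0.
      * by apply/measurable_EFinP/measurable_funX/measurable_funB.
      * by apply: emeasurable_funD => //; apply/measurable_EFinP/measurable_funX.
      * by move=> x _; rewrite -EFinD lee_fin; have := sqr_ge0 x; nra.
    rewrite ge0_integralD//=.
    * by rewrite integral_cst//= probability_setT mule1 EFinD leeD2r.
    * by move=> x _; rewrite lee_fin sqr_ge0.
    * by apply/measurable_EFinP/measurable_funX.
    * by move=> x _; rewrite lee_fin sqr_ge0.
  + under eq_integral do rewrite EFinB.
    rewrite integralB//=; last exact: finite_measure_integrable_cst.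
    by rewrite vE integral_cst//= probability_setT mule1 subee.
Qed.

End normal.

(** * Tail bounds and finite sums *)

Section tails.
Context {R : realType} {d} {T : measurableType d} (P : probability T R).

Lemma centered_tail (f : T -> R) v (t : R) : 0 < t -> centered P f v ->
  (P [set x | (t <= f x)%R] <= (v / t ^+ 2)%R%:E)%E.
Proof.
move=> t0 cf; apply: le_trans (centered_markov t0 cf); have [mf _ _] := cf.
apply: le_measure.
- by rewrite inE -[X in measurable X]setTI; exact: measurable_fun_le.
- rewrite inE -[X in measurable X]setTI; apply: measurable_fun_le => //.
  exact: measurableT_comp.
- by move=> x /= /le_trans; apply; exact: ler_norm.
Qed.

(** If [|L|] and [|V|] are both below [B / 4], then [B + L + V > B / 2 >= t]. A union bound and
    Chebyshev's inequality handle the rest; this controls the error of the second kind. *)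
Lemma shifted_tail (L V : T -> R) (a b B t : R) :
  0 < B -> 2 * t <= B -> centered P L a -> centered P V b ->
  (P [set x | (B + L x + V x < t)%R] <= ((a + b) / (B / 4) ^+ 2)%R%:E)%E.
Proof.
move=> B0 tB cL cV.
have B4 : 0 < B / 4 by rewrite divr_gt0.
have [mL _ _] := cL; have [mV _ _] := cV.
have mabs (f : T -> R) : measurable_fun [set: T] f ->
    measurable [set x | B / 4 <= `|f x|].
  move=> mf; rewrite -[X in measurable X]setTI; apply: measurable_fun_le => //.
  exact: measurableT_comp.
apply: (@le_trans _ _ (P ([set x | (B / 4 <= `|L x|)%R] `|` [set x | (B / 4 <= `|V x|)%R]))).
  apply: le_measure.
  - rewrite inE -[X in measurable X]setTI; under eq_set do rewrite -lte_fin.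
    apply: measurable_lte => //; apply/measurable_EFinP.
    by apply: measurable_funD => //; exact: measurable_funD.
  - by rewrite inE; apply: measurableU; exact: mabs.
  - move=> x /=; case: (lerP (B / 4) `|L x|) => [|Ls]; first by left.
    case: (lerP (B / 4) `|V x|) => [|Vs]; first by right.
    by move: Ls Vs; rewrite !ltr_norml => /andP[Ls _] /andP[Vs _]; lra.
rewrite mulrDl EFinD; apply: le_trans (leeD (centered_markov B4 cL) (centered_markov B4 cV)).
by apply: measureU2; exact: mabs.
Qed.

End tails.

(** * Euclidean inequalities, Lipschitz bounds and group sizes *)

Section finite_sums.
Context {R : realType}.

(** The sum of the squares of [B * a i - X * b i] equals [B * (A * B - X ^+ 2)]. One divides by [B]
    when it is positive; otherwise every [b i] is zero. *)
Lemma cauchy_schwarz_sum (I : finType) (p : pred I) (a b : I -> R) :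
  (\sum_(i | p i) a i * b i) ^+ 2 <=
  (\sum_(i | p i) a i ^+ 2) * (\sum_(i | p i) b i ^+ 2).
Proof.
set A := \sum_(i | p i) a i ^+ 2; set B := \sum_(i | p i) b i ^+ 2.
set X := \sum_(i | p i) a i * b i.
have B0 : 0 <= B by apply: sumr_ge0 => i _; exact: sqr_ge0.
have : 0 <= \sum_(i | p i) (B * a i - X * b i) ^+ 2.
  by apply: sumr_ge0 => i _; exact: sqr_ge0.
have -> : \sum_(i | p i) (B * a i - X * b i) ^+ 2 =
    B ^+ 2 * A - 2 * B * X * X + X ^+ 2 * B.
  transitivity (\sum_(i | p i) (B ^+ 2 * a i ^+ 2 + - (2 * B * X) * (a i * b i) +
      X ^+ 2 * b i ^+ 2)); first by apply: eq_bigr => i _; ring.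
  by rewrite !big_split/= -!mulr_sumr -/A -/B -/X; ring.
move=> h; move: B0; rewrite le_eqVlt => /predU1P[B0|B0].
  suff -> : X = 0 by rewrite expr0n/= -B0 mulr0.
  rewrite /X big1// => i pi; suff -> : b i = 0 by rewrite mulr0.
  have /psumr_eq0P : \sum_(i | p i) b i ^+ 2 = 0 by [].
  by move=> /(_ (fun i _ => sqr_ge0 (b i)) i pi)/eqP; rewrite sqrf_eq0 => /eqP.
by rewrite -(ler_pM2l B0); lra.
Qed.

(** The reverse triangle inequality of the Euclidean norm; squaring it leaves Cauchy-Schwarz. *)
Lemma sqrt_sum_lipschitz (I : finType) (a b : I -> R) :
  `|Num.sqrt (\sum_i a i ^+ 2) - Num.sqrt (\sum_i b i ^+ 2)| <=
  Num.sqrt (\sum_i (a i - b i) ^+ 2).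
Proof.
have a0 : 0 <= \sum_i a i ^+ 2 by apply: sumr_ge0 => i _; exact: sqr_ge0.
have b0 : 0 <= \sum_i b i ^+ 2 by apply: sumr_ge0 => i _; exact: sqr_ge0.
rewrite -sqrtr_sqr ler_wsqrtr//.
rewrite sqrrB !sqr_sqrtr// (_ : \sum_i (a i - b i) ^+ 2 =
    \sum_i a i ^+ 2 - (\sum_i a i * b i) *+ 2 + \sum_i b i ^+ 2); last first.
  by rewrite -sumrMnl -sumrB -big_split/=; apply: eq_bigr => i _; rewrite sqrrB.
rewrite lerD2r lerD2l lerN2 lerMn2r/= -sqrtrM//.
by rewrite (le_trans (ler_norm _))// -sqrtr_sqr ler_wsqrtr// cauchy_schwarz_sum.
Qed.

Lemma sqr_sum_le (I : finType) (p : pred I) (a : I -> R) :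
  (\sum_(i | p i) a i) ^+ 2 <= (\sum_(i | p i) 1) * (\sum_(i | p i) a i ^+ 2).
Proof.
have := @cauchy_schwarz_sum _ p (fun=> 1) a.
by under eq_bigr do rewrite mul1r; under [X in X * _]eq_bigr do rewrite expr1n.
Qed.

Definition group_size k e (c : 'I_k -> 'I_e) (i : 'I_e) : R := \sum_(j < k | c j == i) 1.

Definition group_norm k e (c : 'I_k -> 'I_e) (s : 'I_k -> R) : R :=
  Num.sqrt (\sum_(i < e) ((\sum_(j < k | c j == i) s j) / Num.sqrt (group_size c i)) ^+ 2).

(** Dividing each group sum by the root of the group size makes [s] to group sums a linear
    contraction, by [sqr_sum_le] in each group. *)
Lemma group_norm_lipschitz k e (c : 'I_k -> 'I_e) (s t : 'I_k -> R) :
  `|group_norm c s - group_norm c t| <= Num.sqrt (\sum_j (s j - t j) ^+ 2).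
Proof.
apply: le_trans (sqrt_sum_lipschitz _ _) _; apply: ler_wsqrtr.
rewrite [leRHS](partition_big c predT)//=; apply: ler_sum => i _.
rewrite -mulrBl -sumrB expr_div_n sqr_sqrtr ?sumr_ge0//.
(* An empty group contributes 0, because the inverse of 0 is 0. *)
have [->|k0] := eqVneq (group_size c i) 0.
  by rewrite invr0 mulr0; apply: sumr_ge0 => j _; exact: sqr_ge0.
rewrite ler_pdivrMr ?lt_def ?k0 ?sumr_ge0// mulrC.
exact: sqr_sum_le.
Qed.

Lemma mean_lipschitz k (s t : 'I_k -> R) : (0 < k)%N ->
  `|(\sum_j s j) / Num.sqrt k%:R - (\sum_j t j) / Num.sqrt k%:R| <=
  Num.sqrt (\sum_j (s j - t j) ^+ 2).
Proof.
move=> k0; rewrite -mulrBl -sumrB -sqrtr_sqr ler_wsqrtr//.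
rewrite expr_div_n sqr_sqrtr// ler_pdivrMr ?ltr0n// mulrC.
apply: le_trans (sqr_sum_le _ _) _.
by rewrite sumr_const card_ord.
Qed.

(** The residue class of [i] contains [q * e.+1 + i] for every [q < m %/ e.+1], and rounding the
    quotient down loses at most a factor 2 because it is at least 1. *)
Lemma group_size_ge m e (i : 'I_e.+1) : (e.+1 <= m)%N ->
  m%:R / (2 * e.+1%:R) <= group_size (fun j : 'I_m => inord (j %% e.+1) : 'I_e.+1) i.
Proof.
move=> em; rewrite /group_size sumr_const ler_pdivrMr ?mulr_gt0//.
rewrite -[_ *+ _]/(_%:R) -!natrM ler_nat.
pose A := [pred j : 'I_m | (inord (j %% e.+1) : 'I_e.+1) == i].
rewrite -/(#|A|).
have qA : (m %/ e.+1 <= #|A|)%N.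
  have lt_m (q : 'I_(m %/ e.+1)) : (q * e.+1 + i < m)%N.
    apply: leq_trans (leq_trunc_div m e.+1).
    by rewrite (leq_trans _ (leq_mul (ltn_ord q) (leqnn _)))// mulSn addnC ltn_add2r.
  pose g q := Ordinal (lt_m q).
  have ginj : injective g.
    move=> q q' /(congr1 val)/= /addIn/eqP; rewrite eqn_pmul2r// => /eqP qq.
    exact: val_inj.
  rewrite -[X in (X <= _)%N]card_ord -(card_codom ginj); apply: subset_leq_card.
  apply/fintype.subsetP => j /codomP[q ->]; rewrite inE; apply/eqP/val_inj.
  by rewrite /= inordK ?ltn_pmod// modnMDl modn_small.
(* The remainder is below [e.+1], hence below [(m %/ e.+1) * e.+1]. *)
have : (m < 2 * (m %/ e.+1) * e.+1)%N.
  rewrite {1}(divn_eq m e.+1) mul2n -addnn mulnDl ltn_add2l.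
  rewrite (leq_trans (ltn_pmod m (ltn0Sn e)))// leq_pmull// divn_gt0//.
move=> /ltnW/leq_trans; apply.
by rewrite mulnCA mulnA leq_mul2r leq_mul2l qA orbT.
Qed.

End finite_sums.

(** * The test *)

Lemma probE {R : realType} n m d (S : statistics R m d) f A :
  prob n S f A = (product_law (fun _ : 'I_m => @std_gauss R d) \x
    product_law (aux_law S))%E (observe n f @^-1` A).
Proof. by []. Qed.

Section tests.
Context {R : realType}.
Variables v K : R.
Hypotheses (v0 : 0 <= v) (K0 : 0 <= K).
Hypothesis cZ : centered (@std_normal R) (fun x => x) v.
Hypothesis cZ2 : centered (@std_normal R) (fun x => x ^+ 2 - v) K.

Definition few_machines m d : bool := Num.sqrt m%:R <= d%:R :> R.

(* ['I_d.-1.+1] is convertible to ['I_d] for d > 0, and inhabited for d = 0. *)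
Definition bucket d (j : nat) : 'I_d.-1.+1 := inord (j %% d).

Definition norm_stat n d (x : d.-tuple R * R) : R :=
  (\sum_(i < d) (n%:R * tnth x.1 i ^+ 2 - v)) / Num.sqrt d%:R.

Definition coord_stat n d (j : nat) (x : d.-tuple R * R) : R :=
  Num.sqrt n%:R * nth 0 x.1 (bucket d j).

(** The statistics are deterministic, so each auxiliary law is the point mass at 0. *)
Definition test_stat n m d : statistics R m d :=
  Statistics (fun j => if few_machines m d then @norm_stat n d else @coord_stat n d j)
             (fun=> \d_ (0 : R)).

Definition test_comb (n m d : nat) (s : m.-tuple R) : R :=
  if few_machines m d then (\sum_j tnth s j) / Num.sqrt m%:R
  else group_norm (fun j : 'I_m => bucket d j) (tnth s).

(** The first two terms come from [centered_group_squares]; the 1 makes the constant positive, so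
    that [threshold] is strictly decreasing. *)
Definition var_bound : R := 4 * v ^+ 2 + 2 * K + 1.

(** The solution [t] of [var_bound / t ^+ 2 = a], that is, the cutoff at which Chebyshev's bound
    equals the level. *)
Definition threshold (a : R) : R := Num.sqrt (var_bound / a).

(** In the second regime the squared norm has null mean [d v]; the root appears because [test_comb]
    is the norm itself. *)
Definition test_kappa (n m d : nat) (a : R) : R :=
  if few_machines m d then threshold a
  else Num.sqrt (d%:R * v + threshold a * Num.sqrt d%:R).

Lemma var_bound_gt0 : 0 < var_bound.
Proof. by rewrite /var_bound ltr_wpDl// addr_ge0// mulr_ge0// sqr_ge0. Qed.

Lemma threshold_gt0 a : 0 < a -> 0 < threshold a.
Proof. by move=> a0; rewrite sqrtr_gt0 divr_gt0// var_bound_gt0. Qed.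

Lemma threshold_decr a b : 0 < a -> a < b -> threshold b < threshold a.
Proof.
move=> a0 ab; have b0 := lt_trans a0 ab.
by rewrite ltr_sqrt ?divr_gt0 ?var_bound_gt0// ltr_pM2l ?var_bound_gt0// ltf_pV2.
Qed.

Lemma test_kappa_decr n m d a b : (0 < d)%N -> 0 < a -> a < b ->
  test_kappa n m d b < test_kappa n m d a.
Proof.
move=> d0 a0 ab; rewrite /test_kappa; case: ifP => _; first exact: threshold_decr.
have d0' : 0 < Num.sqrt d%:R :> R by rewrite sqrtr_gt0 ltr0n.
rewrite ltr_sqrt; first by rewrite ltrD2l ltr_pM2r// threshold_decr.
by rewrite ltr_wpDl// ?mulr_ge0// mulr_gt0// threshold_gt0.
Qed.

Lemma test_comb_lipschitz n m d : (0 < m)%N ->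
  condA2 (@test_comb n m d) 1 2 2^-1.
Proof.
move=> m0 s s'; rewrite mul1r powR12_sqrt; last first.
  by apply: sumr_ge0 => j _; exact: powR_ge0.
under eq_bigr do rewrite (powR_mulrn 2)// real_normK ?num_real//.
rewrite /test_comb; case: ifP => _; first exact: mean_lipschitz.
exact: group_norm_lipschitz.
Qed.

(** * Centered functions of one Gaussian vector *)

Section gaussian.
Variable d : nat.

Lemma centered_gauss_coord (i : 'I_d) :
  centered (@std_gauss R d) (fun x => tnth x i) v.
Proof. exact: (@centered_tnth _ _ _ _ (fun=> std_normal) i _ _ cZ). Qed.

Lemma centered_gauss_coord_sq (i : 'I_d) :
  centered (@std_gauss R d) (fun x => tnth x i ^+ 2 - v) K.
Proof. exact: (@centered_tnth _ _ _ _ (fun=> std_normal) i _ _ cZ2). Qed.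

Lemma centered_gauss_norm :
  centered (@std_gauss R d) (fun x => \sum_(i < d) (tnth x i ^+ 2 - v)) (d%:R * K).
Proof.
have := @centered_sum _ _ _ d (fun=> std_normal) (fun=> fun x => x ^+ 2 - v) (fun=> K) (fun=> cZ2).
by rewrite sumr_const card_ord mulr_natl.
Qed.

Lemma centered_gauss_linear (f : d.-tuple R) :
  centered (@std_gauss R d) (fun x => \sum_(i < d) tnth f i * tnth x i)
    (l2norm f ^+ 2 * v).
Proof.
have := @centered_sum _ _ _ d (fun=> std_normal) (fun i x => tnth f i * x)
  (fun i => tnth f i ^+ 2 * v) (fun i => centeredZ (tnth f i) cZ).
by rewrite -mulr_suml sqr_sqrtr// sumr_ge0// => i _; exact: sqr_ge0.
Qed.

End gaussian.

(** The shift that [f] causes in the mean of the statistic once the normalisations are multiplied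
    out (squared norm in the second regime). *)
Definition signal n m d (f : d.-tuple R) : R :=
  if few_machines m d then m%:R * n%:R * l2norm f ^+ 2
  else n%:R * \sum_(j < m) nth 0 f (bucket d j) ^+ 2.

Definition noise_scale m d : R := if few_machines m d then (m * d)%:R else d%:R.

Lemma noise_scale_ge1 m d : (0 < m)%N -> (0 < d)%N -> 1 <= noise_scale m d.
Proof. by rewrite /noise_scale; case: ifP => _ ? ?; rewrite ler1n ?muln_gt0 => //; apply/andP. Qed.

(** Here [d ^+ 2 <= m]. The consequence [d <= m] guarantees that no bucket is empty. *)
Lemma many_machines_leq m d : ~~ few_machines m d -> (d <= m)%N.
Proof.
rewrite -ltNge => dm; rewrite -(ler_nat R).
have : d%:R * d%:R <= m%:R :> R.
  by rewrite -[leRHS]sqr_sqrtr// expr2 ler_pM// ltW.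
by apply: le_trans; rewrite -natrM ler_nat; case: (d) => // e; rewrite leq_pmulr.
Qed.

(** The common interface of the two regimes for level and power. Asking that [L] vanish pointwise at
    [f = 0], rather than almost surely, lets the rejection event be rewritten as an equality of
    sets. *)
Definition test_decomposes n m d (f : d.-tuple R) : Prop :=
  exists L V : m.-tuple (d.-tuple R) -> R,
  [/\ centered (product_law (fun _ : 'I_m => @std_gauss R d)) L (4 * v * signal n m f),
      centered (product_law (fun _ : 'I_m => @std_gauss R d)) V (var_bound * noise_scale m d),
      f = zero_vec d -> forall z, L z = 0 &
      forall a w, 0 < a ->
        comb_test (test_stat n m d) (@test_comb n m d) (test_kappa n m d a) (observe n f w)
        = (threshold a * Num.sqrt (noise_scale m d) <= signal n m f + L w.1 + V w.1)].

(** Expanding [n |X_j|^2 - d v] with [X_j = f + Z_j / r] gives [r ^+ 2 |f|^2], the cross term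
    [2 r <f, Z_j>] and a centered chi-square. Multiplying by [sqrt m] and [sqrt d] clears the
    normalisations. *)
Lemma few_machines_decomposition n m d (f : d.-tuple R) :
  (0 < n)%N -> (0 < m)%N -> (0 < d)%N -> few_machines m d ->
  test_decomposes n m f.
Proof.
move=> n0 m0 d0 sm; pose r : R := Num.sqrt n%:R.
have r0 : r != 0 by rewrite gt_eqF// sqrtr_gt0 ltr0n.
have r2 : n%:R = r ^+ 2 by rewrite sqr_sqrtr.
exists (fun z => \sum_(j < m) 2 * r * \sum_(i < d) tnth f i * tnth (tnth z j) i).
exists (fun z => \sum_(j < m) \sum_(i < d) (tnth (tnth z j) i ^+ 2 - v)).
rewrite /signal /noise_scale sm; split.
- have := @centered_sum _ _ _ m (fun=> @std_gauss R d)
    (fun=> fun x => 2 * r * \sum_(i < d) tnth f i * tnth x i) _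
    (fun=> centeredZ (2 * r) (centered_gauss_linear f)).
  rewrite sumr_const card_ord -[_ *+ m]mulr_natl; apply: centered_le.
  by rewrite r2 le_eqVlt; apply/orP; left; apply/eqP; ring.
- have := @centered_sum _ _ _ m (fun=> @std_gauss R d)
    (fun=> fun x => \sum_(i < d) (tnth x i ^+ 2 - v)) _ (fun=> centered_gauss_norm d).
  rewrite sumr_const card_ord -[_ *+ m]mulr_natl mulrA -natrM mulrC; apply: centered_le.
  by rewrite ler_wpM2r// /var_bound -addrA ler_wpDl ?mulr_ge0 ?sqr_ge0//; have := K0; lra.
- move=> -> z; rewrite big1// => j _; rewrite big1 ?mulr0// => i _.
  by rewrite tnth_mktuple mul0r.
- move=> a w a0; rewrite /comb_test /test_kappa /test_comb sm.
  have d0' : 0 < Num.sqrt d%:R :> R by rewrite sqrtr_gt0 ltr0n.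
  have m0' : 0 < Num.sqrt m%:R :> R by rewrite sqrtr_gt0 ltr0n.
  rewrite ler_pdivlMr// natrM sqrtrM//.
  under eq_bigr do rewrite tnth_mktuple /stat /= sm /norm_stat.
  rewrite -mulr_suml ler_pdivlMr// -mulrA; congr (_ <= _).
  rewrite -addrA -big_split/=.
  rewrite [X in X + _](_ : _ = \sum_(j < m) n%:R * l2norm f ^+ 2); last first.
    by rewrite sumr_const card_ord -[RHS]mulr_natl mulrA.
  rewrite -big_split/=; apply: eq_bigr => j _.
  rewrite !tnth_mktuple sqr_sqrtr ?sumr_ge0// => [|i _]; last exact: sqr_ge0.
  rewrite !mulr_sumr -!big_split/=; apply: eq_bigr => i _.
  by rewrite tnth_mktuple -/r r2; field.
Qed.

(** The sum of group [i] is [k i * r * f_i + A i]; its square over [k i], minus [v], is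
    [k i * r ^+ 2 * f_i ^+ 2], plus [2 r f_i A i], plus the centered term
    [(A i ^+ 2 - v * k i) / k i]. *)
Lemma many_machines_decomposition n m d (f : d.-tuple R) :
  (0 < n)%N -> (0 < m)%N -> (0 < d)%N -> ~~ few_machines m d ->
  test_decomposes n m f.
Proof.
case: d f => // e f n0 m0 d0 lg; pose r : R := Num.sqrt n%:R.
have r0 : r != 0 by rewrite gt_eqF// sqrtr_gt0 ltr0n.
have r2 : n%:R = r ^+ 2 by rewrite sqr_sqrtr.
pose c (j : 'I_m) : 'I_e.+1 := bucket e.+1 j.
pose k i : R := group_size c i.
have k0 i : 0 < k i.
  apply: lt_le_trans (group_size_ge _ (many_machines_leq lg)).
  by rewrite divr_gt0 ?mulr_gt0// ltr0n.
have fE (j : 'I_m) (x : e.+1.-tuple R) : nth 0 x (bucket e.+1 j) = tnth x (c j).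
  by rewrite (tnth_nth 0).
pose A i (z : m.-tuple (e.+1.-tuple R)) := \sum_(j < m | c j == i) tnth (tnth z j) (c j).
exists (fun z => \sum_(j < m) (2 * r * tnth f (c j)) * tnth (tnth z j) (c j)).
exists (fun z => \sum_(i < e.+1) (k i)^-1 * (A i z ^+ 2 - v * k i)).
rewrite /signal /noise_scale (negbTE lg); split.
- have := @centered_sum _ _ _ m (fun=> @std_gauss R e.+1)
    (fun j x => 2 * r * tnth f (c j) * tnth x (c j)) _
    (fun j => centeredZ (2 * r * tnth f (c j)) (centered_gauss_coord (c j))).
  apply: centered_le; rewrite r2 !mulr_sumr ler_sum// => j _.
  by rewrite fE le_eqVlt; apply/orP; left; apply/eqP; ring.
- have := @centered_group_squares _ _ _ m _ c (fun i => (k i)^-1)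
    (fun=> @std_gauss R e.+1) (fun j x => tnth x (c j)) v K v0
    (fun j => centered_gauss_coord (c j)) (fun j => centered_gauss_coord_sq (c j)).
  apply: centered_le.
  (* The weight [(k i)^-1] squared cancels the squared group size, so the bound depends on [d] but
     not on [m]. *)
  rewrite (eq_bigr (fun=> 4 * v ^+ 2 + 2 * K)) => [|i _]; last first.
    by rewrite -/(group_size c i) -/(k i) -exprMn mulVf ?gt_eqF// expr1n mul1r.
  by rewrite sumr_const card_ord -[_ *+ _]mulr_natr ler_wpM2r// /var_bound lerDl.
- move=> -> z; rewrite big1// => j _.
  by rewrite tnth_mktuple mulr0 mul0r.
- move=> a w a0; rewrite /comb_test /test_kappa /test_comb (negbTE lg).
  rewrite ler_sqrt; last by apply: sumr_ge0 => i _; exact: sqr_ge0.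
  rewrite -lerBrDl; congr (_ <= _).
  rewrite [X in X + _ + _](_ : _ = \sum_(i < e.+1) k i * (r ^+ 2 * tnth f i ^+ 2)); last first.
    rewrite mulr_sumr (partition_big c predT)//=; apply: eq_bigr => i _.
    rewrite mulr_suml; apply: eq_bigr => j /eqP cj.
    by rewrite fE cj r2 mul1r.
  rewrite [X in _ + X + _](_ : _ = \sum_(i < e.+1) 2 * r * tnth f i * A i w.1); last first.
    rewrite (partition_big c predT)//=; apply: eq_bigr => i _.
    by rewrite mulr_sumr; apply: eq_bigr => j /eqP ->.
  rewrite [X in _ - X](_ : _ = \sum_(i < e.+1) v); last first.
    by rewrite sumr_const card_ord -[RHS]mulr_natl.
  rewrite -sumrB -!big_split/=; apply: eq_bigr => i _.
  rewrite -/(group_size c i) -/(k i) expr_div_n sqr_sqrtr ?(ltW (k0 i))//.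
  rewrite (_ : \sum_(j < m | _) _ = k i * (r * tnth f i) + A i w.1); last first.
    rewrite mulr_suml -big_split/=; apply: eq_bigr => j /eqP cji.
    have cj : c j = i by [].
    rewrite !tnth_mktuple /stat /= (negbTE lg) /coord_stat fE !tnth_mktuple cj -/r.
    by field.
  by field; rewrite gt_eqF.
Qed.

Lemma test_decomposition n m d (f : d.-tuple R) :
  (0 < n)%N -> (0 < m)%N -> (0 < d)%N ->
  test_decomposes n m f.
Proof.
move=> n0 m0 d0; have [sm|lg] := boolP (few_machines m d).
  exact: few_machines_decomposition.
exact: many_machines_decomposition.
Qed.

(** This is where the rate arises. In the first regime [m n |f|^2] is compared with [sqrt (m d)]; in
    the second, each group has size at least [m / (2 d)], so the signal is at least
    [m n |f|^2 / (2 d)], compared with [sqrt d]. The factor 2 in the hypothesis pays for this group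
    size bound. *)
Lemma signal_ge n m d (f : d.-tuple R) (c : R) :
  (0 < n)%N -> (0 < m)%N -> (0 < d)%N -> 0 <= c ->
  2 * c * (Num.min (Num.sqrt m%:R) d%:R * Num.sqrt d%:R / (m%:R * n%:R)) <= l2norm f ^+ 2 ->
  c * Num.sqrt (noise_scale m d) <= signal n m f.
Proof.
move=> n0 m0 d0 c0.
have mn0 : 0 < m%:R * n%:R :> R by rewrite mulr_gt0// ltr0n.
rewrite mulrA ler_pdivrMr// /signal /noise_scale => fc.
have [sm|lg] := boolP (few_machines m d).
  move: fc; rewrite (min_idPl sm) natrM sqrtrM// [_ ^+ 2 * _]mulrC.
  apply: le_trans; rewrite -[leRHS]mulrA ler_peMl ?ler1n//.
  by rewrite !mulr_ge0// sqrtr_ge0.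
case: d f d0 lg fc => // e f d0 lg.
rewrite min_r; last by rewrite ltW// ltNge.
move=> fc; pose k i : R := group_size (fun j : 'I_m => bucket e.+1 j) i.
have -> : \sum_(j < m) nth 0 f (bucket e.+1 j) ^+ 2 = \sum_(i < e.+1) k i * tnth f i ^+ 2.
  rewrite (partition_big (fun j : 'I_m => bucket e.+1 j) predT)//=.
  apply: eq_bigr => i _; rewrite mulr_suml; apply: eq_bigr => j /eqP <-.
  by rewrite mul1r (tnth_nth 0).
apply: (@le_trans _ _ (n%:R * \sum_(i < e.+1) m%:R / (2 * e.+1%:R) * tnth f i ^+ 2)); last first.
  rewrite ler_wpM2l// ler_sum// => i _; rewrite ler_wpM2r ?sqr_ge0//.
  exact: group_size_ge (many_machines_leq lg).
rewrite -mulr_sumr.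
have -> : \sum_(i < e.+1) tnth f i ^+ 2 = l2norm f ^+ 2.
  by rewrite sqr_sqrtr// sumr_ge0// => i _; exact: sqr_ge0.
have e0 : 0 < e.+1%:R :> R by rewrite ltr0n.
have e2 : 0 < 2 * e.+1%:R :> R by rewrite mulr_gt0.
rewrite -(ler_pM2l e2) (_ : _ * (_ * (_ / _ * _)) = l2norm f ^+ 2 * (m%:R * n%:R)); last first.
  by field; rewrite -(natrD _ 1) pnatr_eq0.
by apply: le_trans fc; rewrite le_eqVlt; apply/orP; left; apply/eqP; ring.
Qed.

Lemma signal0 n m d : signal n m (@zero_vec R d) = 0.
Proof.
rewrite /signal /l2norm; case: ifP => _.
  rewrite big1 ?sqrtr0 ?expr0n ?mulr0// => i _.
  by rewrite tnth_mktuple expr0n.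
rewrite big1 ?mulr0// => j _.
(* For [d = 0] the bucket index is out of range and [nth] returns its default 0. *)
have [b|b] := ltnP (bucket d j) d.
  by rewrite -[nth _ _ _]/(nth 0 _ (Ordinal b)) -tnth_nth tnth_mktuple expr0n.
by rewrite nth_default ?expr0n// size_tuple.
Qed.

(** * Condition (A1), level and power *)

Lemma measurable_test_stat n m d (j : 'I_m) : (0 < d)%N ->
  measurable_fun [set: d.-tuple R * R] (stat_fun (test_stat n m d) j).
Proof.
move=> d0 /=; case: ifP => _.
  apply: measurable_funM => //; apply: measurable_sum => i.
  apply: measurable_funB => //; apply: measurable_funM => //; apply: measurable_funX.
  exact: (measurableT_comp (measurable_tnth i) measurable_fst).
case: d d0 => // e _; apply: measurable_funM => //.
under eq_fun do rewrite -tnth_nth.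
exact: (measurableT_comp (measurable_tnth _) measurable_fst).
Qed.

(** At [f = 0] the factor [n] cancels the noise level. The second moment is at most [K] in one
    regime and [v] in the other, so [K + v] serves for all [n], [m], [d]. *)
Lemma test_stat_null n m d (j : 'I_m) : (0 < n)%N -> (0 < d)%N ->
  exists2 g, centered (@std_gauss R d) g (K + v) &
    forall w, stat (test_stat n m d) j (observe n (zero_vec d) w) = g (tnth w.1 j).
Proof.
move=> n0 d0; have r0 : 0 < Num.sqrt n%:R :> R by rewrite sqrtr_gt0 ltr0n.
have [sm|/negbTE lg] := boolP (few_machines m d).
  exists (fun x => (Num.sqrt d%:R)^-1 * \sum_(i < d) (tnth x i ^+ 2 - v)).
    apply: centered_le (centeredZ _ (centered_gauss_norm d)).
    by rewrite exprVn sqr_sqrtr// mulrA mulVf ?pnatr_eq0 -?lt0n// mul1r lerDl.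
  move=> w; rewrite /stat /= sm mulrC; congr (_ * _); apply: eq_bigr => i _.
  rewrite !tnth_mktuple add0r exprMn exprVn sqr_sqrtr// mulrA mulfV ?mul1r//.
  by rewrite pnatr_eq0 -lt0n.
case: d d0 lg => // e _ lg; exists (fun x => tnth x (bucket e.+1 j)).
  by apply: centered_le (centered_gauss_coord _); rewrite lerDr.
move=> w; rewrite /stat /= lg /coord_stat -tnth_nth !tnth_mktuple add0r.
by rewrite mulrA mulfV ?mul1r// gt_eqF.
Qed.

Lemma test_stat_A1 n m d : (0 < n)%N -> (0 < m)%N -> (0 < d)%N ->
  condA1 n (test_stat n m d) (1 + (K + v)).
Proof.
move=> n0 m0 d0 j; split; first exact: measurable_test_stat.
have [g cg statE] := test_stat_null j n0 d0.
rewrite unlock ge0_integral_distribution; last by move=> w; rewrite lee_fin.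
  rewrite (eq_integral (fun w => `|g (tnth w.1 j)|%:E)); last first.
    by move=> w _; rewrite -statE.
  have := @centered_tnth _ _ _ m (fun=> @std_gauss R d) j _ _ cg.
  move/(centered_fst (product_law (aux_law (test_stat n m d)))) => [mg gv _].
  exact: integral_norm_le mg gv.
apply/measurable_EFinP; apply: measurableT_comp => //.
apply: (measurableT_comp (measurable_test_stat _ _ d0)).
apply: measurable_fun_pair.
  exact: (measurableT_comp (measurable_tnth j) measurable_fst).
exact: (measurableT_comp (measurable_tnth j) measurable_snd).
Qed.

(** Under the null only [V] remains, and by the choice of [threshold] Chebyshev's bound is exactly
    [a]. *)
Lemma test_level n m d : (0 < n)%N -> (0 < m)%N -> (0 < d)%N ->
  condA3 n (test_stat n m d) (@test_comb n m d) (test_kappa n m d).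
Proof.
move=> n0 m0 d0; split=> [a b a0 ab _|a /andP[a0 _]]; first exact: test_kappa_decr.
have [L [V [_ cV L0 testE]]] := test_decomposition (zero_vec d) n0 m0 d0.
rewrite probE.
rewrite (_ : _ @^-1` _ = [set w | threshold a * Num.sqrt (noise_scale m d) <= V w.1]); last first.
  by apply/seteqP; split=> w /=; rewrite testE// signal0 L0// !add0r.
have D1 := noise_scale_ge1 m0 d0; have D0 := lt_le_trans ltr01 D1.
have t0 : 0 < threshold a * Num.sqrt (noise_scale m d).
  by rewrite mulr_gt0 ?threshold_gt0// sqrtr_gt0.
apply: le_trans (centered_tail t0 (centered_fst _ cV)) _.
rewrite lee_fin exprMn !sqr_sqrtr ?(ltW D0)//; last by rewrite divr_ge0 ?ltW// var_bound_gt0.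
rewrite le_eqVlt; apply/orP; left; apply/eqP; field.
by rewrite !gt_eqF// var_bound_gt0.
Qed.

(** Each summand of the constant has its own task: 1 makes the signal positive, [2 * threshold a]
    puts the cutoff below half the signal, and the quotient by [b] makes the Chebyshev bound at most
    [b]. *)
Lemma test_power n m d (f : d.-tuple R) (a b : R) :
  (0 < n)%N -> (0 < m)%N -> (0 < d)%N -> 0 < a -> 0 < b ->
  (1 + 2 * threshold a + (64 * v + 16 * var_bound) / b) * Num.sqrt (noise_scale m d)
    <= signal n m f ->
  (prob n (test_stat n m d) f
    [set w | comb_test (test_stat n m d) (@test_comb n m d) (test_kappa n m d a) w = false]
    <= b%:E)%E.
Proof.
move=> n0 m0 d0 a0 b0.
have [L [V [cL cV _ testE]]] := test_decomposition f n0 m0 d0.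
rewrite probE.
rewrite (_ : _ @^-1` _ = [set w | signal n m f + L w.1 + V w.1 <
    threshold a * Num.sqrt (noise_scale m d)]); last first.
  apply/seteqP; split=> w /=; rewrite testE// ltNge; first by move=> ->.
  by move/negbTE.
move: cL cV; move: (signal n m f) (noise_scale_ge1 m0 d0) => B.
move: (noise_scale m d) => D D1 cL cV.
have D0 := lt_le_trans ltr01 D1.
have t0 := threshold_gt0 a0; have w0 := var_bound_gt0.
pose s := Num.sqrt D; have s1 : 1 <= s by rewrite -sqrtr1 ler_wsqrtr.
have s2 : D = s ^+ 2 by rewrite sqr_sqrtr// ltW.
rewrite -/s; set q := (64 * v + 16 * var_bound) / b => Bs.
have q0 : 0 <= q by rewrite divr_ge0 ?ltW// ltr_wpDl ?mulr_gt0// mulr_ge0.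
have qb : q * b = 64 * v + 16 * var_bound by rewrite divfK// gt_eqF.
have s0 := lt_le_trans ltr01 s1.
have Bs1 : s <= B by apply: le_trans Bs; rewrite ler_peMl ?(ltW s0)//; lra.
have Bt : 2 * (threshold a * s) <= B.
  by apply: le_trans Bs; rewrite mulrA ler_pM2r//; lra.
have Bq : q * s <= B by apply: le_trans Bs; rewrite ler_pM2r//; lra.
have B0 := lt_le_trans s0 Bs1.
apply: le_trans (shifted_tail B0 Bt (centered_fst _ cL) (centered_fst _ cV)) _.
rewrite lee_fin ler_pdivrMr ?exprn_gt0 ?divr_gt0// s2.
(* One factor [B] is bounded below by [q * s]; then [1 <= s] absorbs the linear part and [s <= B]
   the quadratic one. The 16 comes from [(B / 4) ^+ 2]. *)
have : 16 * (4 * v * B + var_bound * s ^+ 2) <= b * B ^+ 2.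
  apply: (@le_trans _ _ (b * (q * s) * B)); last first.
    by rewrite -mulrA ler_pM2l// expr2 ler_pM2r.
  rewrite (_ : b * (q * s) * B = 64 * v * (s * B) + 16 * var_bound * (s * B)); last first.
    by rewrite -mulrDl -qb; ring.
  have vsB : v * B <= v * (s * B) by rewrite ler_wpM2l// ler_peMl// ltW.
  have wsB : var_bound * s ^+ 2 <= var_bound * (s * B) by rewrite ler_pM2l// expr2 ler_pM2l.
  lra.
lra.
Qed.

End tests.

Unset Implicit Arguments.

Theorem theorem2 (R : realType) (alpha beta : R)
    (halpha : 0 < alpha < 1) (hbeta : 0 < beta < 1) :
  exists (S : forall n m d : nat, statistics R m d)
         (C : forall n m d : nat, m.-tuple R -> R)
         (kappa : forall n m d : nat, R -> R),
    [/\ exists2 M : R, 0 < M &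
          forall n m d : nat, (0 < n)%N -> (0 < m)%N -> (0 < d)%N ->
            condA1 n (S n m d) M,
        exists L p q : R, [/\ 0 < L, 0 < p, 0 < q &
          forall n m d : nat, (0 < n)%N -> (0 < m)%N -> (0 < d)%N ->
            condA2 (C n m d) L p q],
        forall n m d : nat, (0 < n)%N -> (0 < m)%N -> (0 < d)%N ->
          condA3 n (S n m d) (C n m d) (kappa n m d) &
        exists2 Cab : R, 0 < Cab &
          forall (n m d : nat) (rho : R),
            (0 < n)%N -> (0 < m)%N -> (0 < d)%N -> 0 < rho ->
            Cab * (Num.min (Num.sqrt m%:R) d%:R * Num.sqrt d%:R
                   / (m%:R * n%:R)) <= rho ^+ 2 ->
            (ereal_sup
              [set prob n (S n m d) f
                     [set w | comb_test (S n m d) (C n m d)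
                                (kappa n m d alpha) w = false]
              | f in H_alt d rho] <= beta%:E)%E].
Proof.
(* These constants depend only on the normal law, so [M] is uniform in [n], [m], [d], and [Cab]
   depends only on [alpha] and [beta]. *)
have [v [K [v0 K0 cZ cZ2]]] := @std_normal_moments R.
have [a0 _] := andP halpha; have [b0 _] := andP hbeta.
have t0 := threshold_gt0 v K0 a0; have w0 := var_bound_gt0 v K0.
exists (test_stat v), (@test_comb R), (test_kappa v K); split.
- exists (1 + (K + v)); first lra.
  by move=> n m d n0 m0 d0; exact: test_stat_A1.
- exists 1, 2, 2^-1; split=> // n m d n0 m0 d0; exact: test_comb_lipschitz.
- by move=> n m d n0 m0 d0; exact: test_level.
- set c := 1 + 2 * threshold v K alpha + (64 * v + 16 * var_bound v K) / beta.
  have c0 : 0 < c by rewrite /c ltr_wpDr ?divr_ge0//; lra.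
  (* [c] is the constant required by [test_power], and the 2 is the one in [signal_ge]. *)
  exists (2 * c); first by rewrite mulr_gt0.
  move=> n m d rho n0 m0 d0 rho0 hrho; apply/ereal_supP => _ [f fH <-].
  apply: test_power => //; apply: signal_ge => //; first exact: ltW.
  apply: le_trans hrho _; rewrite ler_sqr ?nnegrE ?sqrtr_ge0//.
  exact: ltW.
Qed.
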